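(* Let $n,\alpha\in\mathbb{Z}_{\ge 1}$ be such that $3n\equiv 1\pmod{4^{\alpha}}$. Then $d_7(n)\equiv 0\pmod{8^{\alpha}}$.
   Context: For an integer $k\ge 0$, the integers $d_k(n)$, $n\ge 0$ (the number of $k$-elongated plane partition diamonds) are given by the generating function $$\sum_{n=0}^{\infty}d_k(n)q^n = \prod_{m=1}^{\infty}\frac{(1-q^{2m})^k}{(1-q^m)^{3k+1}}.$$ In particular $\sum_{n\ge 0} d_7(n)q^n=\prod_{m\ge 1}(1-q^{2m})^7(1-q^m)^{-22}$. *)

(* Defs.v *)
From HB Require Import structures.
From mathcomp Require Import all_boot all_order all_algebra.
From mathcomp Require Import boolp.
Set Implicit Arguments.
Unset Strict Implicit.
Unset Printing Implicit Defensive.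
Import GRing.Theory.
Local Open Scope ring_scope.

(* Formal power series, given by their coefficients. *)
Record fps (R : Type) := Fps { fcoef : nat -> R }.

Notation "f ``_ n" := (fcoef f n)
  (at level 3, n at level 2, left associativity, format "f ``_ n") : ring_scope.

HB.instance Definition _ (R : Type) := gen_eqMixin (fps R).
HB.instance Definition _ (R : Type) := gen_choiceMixin (fps R).

Lemma fpsP (R : Type) (f g : fps R) : (forall n, f``_n = g``_n) -> f = g.
Proof. by case: f g => [f] [g] /= fg; congr Fps; apply/funext. Qed.

Section Ring.
Variable R : comNzRingType.
Implicit Types f g h : fps R.

Definition fps_zero : fps R := Fps (fun=> 0).
Definition fps_opp f : fps R := Fps (fun n => - f``_n).
Definition fps_add f g : fps R := Fps (fun n => f``_n + g``_n).

Fact fps_addA : associative fps_add.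
Proof. by move=> f g h; apply: fpsP => n /=; rewrite addrA. Qed.
Fact fps_addC : commutative fps_add.
Proof. by move=> f g; apply: fpsP => n /=; rewrite addrC. Qed.
Fact fps_add0 : left_id fps_zero fps_add.
Proof. by move=> f; apply: fpsP => n /=; rewrite add0r. Qed.
Fact fps_addN : left_inverse fps_zero fps_opp fps_add.
Proof. by move=> f; apply: fpsP => n /=; rewrite addNr. Qed.

HB.instance Definition _ :=
  GRing.isZmodule.Build (fps R) fps_addA fps_addC fps_add0 fps_addN.

Definition fps_const (c : R) : fps R := Fps (fun n => if n == 0%N then c else 0).
Definition fps_mul f g : fps R :=
  Fps (fun n => \sum_(i < n.+1) f``_i * g``_(n - i)).

Let trunc n f : {poly R} := \poly_(i < n.+1) f``_i.

Fact coef_trunc n f i : (i <= n)%N -> (trunc n f)`_i = f``_i.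
Proof. by move=> le_in; rewrite coef_poly ltnS le_in. Qed.

Fact fps_mul_trunc n f g i :
  (i <= n)%N -> (fps_mul f g)``_i = (trunc n f * trunc n g)`_i.
Proof.
move=> le_in; rewrite coefM; apply: eq_bigr => j _.
rewrite !coef_trunc //; first exact: leq_trans (leq_subr _ _) le_in.
by apply: leq_trans le_in; rewrite -ltnS.
Qed.

Fact fps_mulC : commutative fps_mul.
Proof.
by move=> f g; apply: fpsP => n; rewrite !(fps_mul_trunc _ _ (leqnn n)) mulrC.
Qed.

Fact fps_mulA : associative fps_mul.
Proof.
move=> f g h; apply: fpsP => n.
transitivity ((trunc n f * (trunc n g * trunc n h))`_n); last first.
  rewrite mulrA coefM; apply: eq_bigr => i _.
  rewrite coef_trunc ?leq_subr // -fps_mul_trunc //.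
  by rewrite -ltnS.
rewrite coefM; apply: eq_bigr => i _.
rewrite coef_trunc -?fps_mul_trunc ?leq_subr //.
by rewrite -ltnS.
Qed.

Fact fps_mul1 : left_id (fps_const 1) fps_mul.
Proof.
move=> f; apply: fpsP => n /=; rewrite big_ord_recl /= subn0 mul1r big1 ?addr0 //.
by move=> i _; rewrite mul0r.
Qed.

Fact fps_mulDl : left_distributive fps_mul fps_add.
Proof.
move=> f g h; apply: fpsP => n /=; rewrite -big_split /=.
by apply: eq_bigr => i _; rewrite mulrDl.
Qed.

Fact fps_1_neq0 : fps_const 1 != 0.
Proof. by apply/eqP => /(congr1 (fun f => f``_0)) /eqP; rewrite /= oner_eq0. Qed.

HB.instance Definition _ := GRing.Zmodule_isComNzRing.Build (fps R)
  fps_mulA fps_mulC fps_mul1 fps_mulDl fps_1_neq0.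

Lemma fcoef0 n : (0 : fps R)``_n = 0. Proof. by []. Qed.
Lemma fcoef1 n : (1 : fps R)``_n = (n == 0%N)%:R.
Proof. by rewrite /=; case: eqP. Qed.
Lemma fcoefD f g n : (f + g)``_n = f``_n + g``_n. Proof. by []. Qed.
Lemma fcoefN f n : (- f)``_n = - f``_n. Proof. by []. Qed.
Lemma fcoefB f g n : (f - g)``_n = f``_n - g``_n. Proof. by []. Qed.
Lemma fcoefM f g n : (f * g)``_n = \sum_(i < n.+1) f``_i * g``_(n - i).
Proof. by []. Qed.
Lemma fcoef_sum (I : Type) (r : seq I) (P : pred I) (F : I -> fps R) n :
  (\sum_(i <- r | P i) F i)``_n = \sum_(i <- r | P i) (F i)``_n.
Proof. by apply: (big_morph (fun f => f``_n)). Qed.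

Definition fpsX : fps R := Fps (fun n => (n == 1%N)%:R).

Lemma fcoefXM f n : (fpsX * f)``_n = if n is m.+1 then f``_m else 0.
Proof.
rewrite fcoefM big_ord_recl /= mul0r add0r.
case: n => [|n]; first by rewrite big_ord0.
rewrite big_ord_recl /= mul1r subSS subn0 big1 ?addr0 // => i _.
by rewrite mul0r.
Qed.

Lemma fcoefXn m n : (fpsX ^+ m)``_n = (n == m)%:R.
Proof.
elim: m n => [|m IHm] n; first exact: fcoef1.
by rewrite exprS fcoefXM; case: n => [|n] //; rewrite IHm eqSS.
Qed.

Lemma fcoef_expr_lt h j n : h``_0 = 0 -> (n < j)%N -> (h ^+ j)``_n = 0.
Proof.
move=> h0; elim: j n => // j IHj n lt_nj.
rewrite exprS fcoefM big_ord_recl h0 mul0r add0r big1 // => i _ /=.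
rewrite IHj ?mulr0 //; apply: leq_ltn_trans (leq_sub2l n (ltn0Sn i)) _.
by case: n lt_nj i => [|n] lt_nj [i lt_i] //=; rewrite subSS subn0.
Qed.

(* The sum over all j of h ^+ j, meaningful when h has no constant term: then
   h ^+ j contributes to the coefficient of index n only for j <= n. *)
Definition fps_geom h : fps R := Fps (fun n => \sum_(j < n.+1) (h ^+ j)``_n).

Lemma fps_geomK h : h``_0 = 0 -> (1 - h) * fps_geom h = 1.
Proof.
move=> h0; apply: fpsP => n.
transitivity (((1 - h) * \sum_(j < n.+1) h ^+ j)``_n).
  rewrite !fcoefM; apply: eq_bigr => i _; congr (_ * _).
  rewrite fcoef_sum /=.
  rewrite (big_ord_widen n.+1 (fun j => (h ^+ j)``_(n - i))) ?ltnS ?leq_subr //.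
  rewrite big_mkcond; apply: eq_bigr => j _.
  by case: leqP => // lt_j; rewrite fcoef_expr_lt.
rewrite -(opprB h 1) mulNr -subrX1 opprB fcoefB.
by rewrite fcoef_expr_lt // subr0.
Qed.

(* The infinite product of the F m for m >= 1, meaningful when F m = 1 mod q^m:
   then no factor of index m > n affects the coefficient of index n. *)
Definition fps_infprod (F : nat -> fps R) : fps R :=
  Fps (fun n => (\prod_(1 <= m < n.+1) F m)``_n).

Lemma fps_infprodE (F : nat -> fps R) n N :
    (forall m i, (0 < m)%N -> (i < m)%N -> (F m)``_i = (i == 0%N)%:R) ->
  (n <= N)%N -> (fps_infprod F)``_n = (\prod_(1 <= m < N.+1) F m)``_n.
Proof.
move=> F1 /subnK <-; elim: (N - n)%N => // d ->.
rewrite addSn; set P := \prod_(1 <= m < _) F m.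
have -> : \prod_(1 <= m < (d + n).+2) F m = F (d + n).+1 * P.
  by rewrite big_nat_recr // mulrC.
rewrite fcoefM big_ord_recl F1 // mul1r subn0 big1 ?addr0 // => i _.
by rewrite F1 ?mul0r //= !ltnS; case: i => i /= /leq_trans; apply; rewrite leq_addl.
Qed.

End Ring.

Section Unit.
Variable R : comUnitRingType.
Implicit Types f g h : fps R.

Definition fps_unit : {pred fps R} := [pred f : fps R | f``_0 \is a GRing.unit].
Definition fps_inv f : fps R :=
  if f \in fps_unit then
    fps_const (f``_0)^-1 * fps_geom (1 - fps_const (f``_0)^-1 * f)
  else f.

Fact fps_mulVr : {in fps_unit, left_inverse 1 fps_inv *%R}.
Proof.
move=> f uf; rewrite /fps_inv uf; set c := fps_const _.
have cf : c * f = 1 - (1 - c * f) by rewrite opprB addrC subrK.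
rewrite mulrAC [X in X * _]cf; apply: fps_geomK.
by rewrite fcoefB fcoefM big_ord_recl big_ord0 addr0 /= mulVr ?subrr.
Qed.

Fact fps_unitPl f g : g * f = 1 -> f \in fps_unit.
Proof.
move=> /(congr1 (fun f => f``_0)) /=; rewrite big_ord_recl big_ord0 addr0 /= => gf1.
by apply/unitrPr; exists g``_0; rewrite mulrC.
Qed.

Fact fps_invr_out : {in [predC fps_unit], fps_inv =1 id}.
Proof. by move=> f /negbTE; rewrite /fps_inv => ->. Qed.

HB.instance Definition _ := GRing.ComNzRing_hasMulInverse.Build (fps R)
  fps_mulVr fps_unitPl fps_invr_out.

Lemma fps_unitE f : (f \is a GRing.unit) = (f``_0 \is a GRing.unit).
Proof. by []. Qed.

End Unit.

Definition diamond_factor (k m : nat) : fps int :=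
  let q := fpsX int in
  (1 - q ^+ (2 * m)) ^+ k / (1 - q ^+ m) ^+ (3 * k + 1).

Definition diamond_gf (k : nat) : fps int := fps_infprod (diamond_factor k).

(* The number of k-elongated plane partition diamonds. *)
Definition d (k n : nat) : int := (diamond_gf k)``_n.

Section OneModXm.

Let one_mod (m : nat) (f : fps int) :=
  forall i, (i < m)%N -> f``_i = (i == 0%N)%:R.

Fact one_modM m f g : one_mod m f -> one_mod m g -> one_mod m (f * g).
Proof.
move=> f1 g1 i lt_im; rewrite fcoefM big_ord_recl /= subn0.
rewrite f1 ?(leq_ltn_trans _ lt_im) // mul1r g1 // big1 ?addr0 // => j _.
by rewrite f1 ?mul0r // (leq_ltn_trans _ lt_im) //=; case: j.
Qed.

Fact one_modX m f k : one_mod m f -> one_mod m (f ^+ k).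
Proof.
move=> f1; elim: k => [|k IHk]; first by move=> i _; apply: fcoef1.
by rewrite exprS; apply: one_modM.
Qed.

Fact one_mod_div m f g : f * g = 1 -> one_mod m g -> one_mod m f.
Proof.
move=> fg g1 i; elim/ltn_ind: i => i IHi lt_im.
have := congr1 (fun f => f``_i) fg; rewrite fcoef1 fcoefM big_ord_recr /= subnn.
rewrite (g1 0%N) ?(leq_ltn_trans _ lt_im) // mulr1.
rewrite big1 ?add0r // => j _.
rewrite g1 ?(leq_ltn_trans (leq_subr _ _) lt_im) //.
by rewrite subn_eq0 leqNgt ltn_ord mulr0.
Qed.

Fact one_mod_subX m j : (0 < m <= j)%N -> one_mod m (1 - fpsX int ^+ j).
Proof.
move=> /andP[m0 le_mj] i lt_im; rewrite fcoefB fcoef1 fcoefXn.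
by rewrite (ltn_eqF (leq_trans lt_im le_mj)) subr0.
Qed.

Fact subX_unit m k : (0 < m)%N -> (1 - fpsX int ^+ m) ^+ k \is a GRing.unit.
Proof.
move=> m0; rewrite fps_unitE.
by rewrite (@one_modX m) ?unitr1 //; apply: one_mod_subX; rewrite m0 leqnn.
Qed.

Lemma diamond_factor_one_mod k m i : (0 < m)%N -> (i < m)%N ->
  (diamond_factor k m)``_i = (i == 0%N)%:R.
Proof.
move=> m0; apply: one_modM; first apply/one_modX/one_mod_subX.
  by rewrite m0 leq_pmull.
apply: one_mod_div (mulVr (subX_unit _ m0)) _; apply/one_modX/one_mod_subX.
by rewrite m0 leqnn.
Qed.

Lemma d_partial_prod k n N : (n <= N)%N ->
  d k n = (\prod_(1 <= m < N.+1) diamond_factor k m)``_n.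
Proof. exact/fps_infprodE/diamond_factor_one_mod. Qed.

End OneModXm.

(* Main.v *)
Require Import Defs.
From mathcomp Require Import all_boot all_order all_algebra.
From HB Require Import structures.
From mathcomp Require Import ring zify.

(** Write U for the operator (U f)_n = f_(2n), V f for f(q^2), phi and psi for
    Ramanujan's theta functions and f_k for Euler's product in q^k.  The
    generating function is G_0 = 1 / (f_1^8 phi(-q)^7), and if
    G_(a+1) = U (U (q G_a)) then the coefficient of q^K (K > 0) in G_a is d_7(n)
    for 3n - 1 = 4^a (3K - 1).

    Everything rests on phi(q)^2 = phi(q^2)^2 + 4q psi(q^4)^2.  It makes
    v = phi(q)/phi(-q^2) satisfy v + 1/v = 2 V c, c = phi(q^2)/phi(-q),
    c^2 = (v^4 + 1)/2, and turns the eta quotient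
    x = q f_4^8 / f_1^8 = (v^8 - 1)/16 into a root of x^2 = V t (1 + 16 x),
    with t = x (1 + 16 x); U applied to polynomials in x is thus computed by a
    linear recurrence of order two.  One finds
    G_(a+1) = phi(q) phi(-q)^-8 f_1^-8 Q_a(x), and, in terms of X = 8x, passing
    from Q_a to Q_(a+1) maps X Z[X] into 8 X Z[X]. *)

Set Implicit Arguments.
Unset Strict Implicit.
Unset Printing Implicit Defensive.

Module Diamonds.
Import GRing.Theory Num.Theory.
Local Open Scope ring_scope.

Notation q := (fpsX int).
Implicit Types f g h : fps int.

(** * The substitution q -> q^2 and the even section *)

Definition fps_sub2 f : fps int := Fps (fun n => if odd n then 0 else f``_(n./2)).

Definition fps_sect2 f : fps int := Fps (fun n => f``_(n.*2)).

Notation V := fps_sub2.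
Notation U := fps_sect2.

Lemma sum_even (W : nmodType) (F : nat -> W) k :
  \sum_(i < k.*2.+1) (if odd i then 0 else F i) = \sum_(i < k.+1) F i.*2.
Proof.
elim: k => [|k IHk]; first by rewrite !big_ord_recr !big_ord0.
by rewrite doubleS 2!big_ord_recr [RHS]big_ord_recr /= IHk odd_double addr0.
Qed.

Fact sub2_is_zmod_morphism : zmod_morphism V.
Proof. by move=> f g; apply: fpsP => n /=; case: ifP; rewrite ?subr0. Qed.

HB.instance Definition _ :=
  GRing.isZmodMorphism.Build (fps int) (fps int) V sub2_is_zmod_morphism.

Fact sub2_is_monoid_morphism : monoid_morphism V.
Proof.
split=> [|f g]; apply: fpsP => n; first by case: n => [|[|n]] //=; case: ifP.
case: (boolP (odd n)) => [n_odd|n_even].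
  rewrite fcoefM [LHS]/= n_odd big1 // => i _ /=.
  rewrite oddB -1?ltnS // n_odd.
  by case: (odd i); rewrite /= ?mul0r ?mulr0.
rewrite -(even_halfK n_even); move: n./2 => k.
rewrite fcoefM /= odd_double doubleK.
rewrite (eq_bigr (fun i : 'I_k.*2.+1 => if odd i then 0 else
   f``_(i./2) * g``_((k.*2 - i)./2))); last first.
  move=> i _; rewrite oddB -1?ltnS // odd_double.
  by case: (odd i); rewrite /= ?mul0r.
rewrite (sum_even (fun i => f``_(i./2) * g``_((k.*2 - i)./2))).
by apply: eq_bigr => i _; rewrite doubleK -doubleB doubleK.
Qed.

HB.instance Definition _ :=
  GRing.isMonoidMorphism.Build (fps int) (fps int) V sub2_is_monoid_morphism.

Lemma sub2D f g : V (f + g) = V f + V g.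
Proof. exact: (raddfD V). Qed.

Lemma sub2B f g : V (f - g) = V f - V g.
Proof. exact: (raddfB V). Qed.

Lemma sub2M f g : V (f * g) = V f * V g.
Proof. exact: (rmorphM V). Qed.

Lemma sub2_1 : V 1 = 1.
Proof. exact: (rmorph1 V). Qed.

Lemma sub2_exp f k : V (f ^+ k) = V f ^+ k.
Proof. exact: (rmorphXn V). Qed.

Lemma sub2_nat k : V k%:R = k%:R.
Proof. exact: (rmorph_nat V). Qed.

Lemma sub2_inv f : f \is a GRing.unit -> V f^-1 = (V f)^-1.
Proof. exact: (rmorphV V). Qed.

Definition sub2E := (sub2B, sub2D, sub2M, sub2_exp, sub2_1, sub2_nat).

Fact sect2_is_zmod_morphism : zmod_morphism U.
Proof. by move=> f g; apply: fpsP. Qed.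

HB.instance Definition _ :=
  GRing.isZmodMorphism.Build (fps int) (fps int) U sect2_is_zmod_morphism.

(** No odd power of q occurs in [V f], so [U] is linear over series in q^2. The computations of [U]
    below rest on pulling out such factors. *)
Lemma sect2M f g : U (V f * g) = f * U g.
Proof.
apply: fpsP => k; rewrite !fcoefM /=.
rewrite (eq_bigr (fun i : 'I_k.*2.+1 => if odd i then 0 else
   f``_(i./2) * g``_(k.*2 - i))); last first.
  by move=> i _; case: (odd i); rewrite ?mul0r.
rewrite (sum_even (fun i => f``_(i./2) * g``_(k.*2 - i))).
by apply: eq_bigr => i _; rewrite doubleK -doubleB.
Qed.

Lemma sub2X : V q = q ^+ 2.
Proof.
by apply: fpsP => n; rewrite fcoefXn /=; case: n => [|[|[|[|n]]]] //=; case: ifP.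
Qed.

Lemma sect2XM f : U (q * V f) = 0.
Proof.
apply: fpsP => n; rewrite -[LHS]/((q * V f)``_(n.*2)) fcoefXM.
by case: n => //= n; rewrite odd_double.
Qed.

Lemma sect2D f g : U (f + g) = U f + U g.
Proof. exact: (raddfD U). Qed.

Lemma sect2B f g : U (f - g) = U f - U g.
Proof. exact: (raddfB U). Qed.

Lemma sect2_nat n f : U (n%:R * f) = n%:R * U f.
Proof. by rewrite !mulr_natl raddfMn. Qed.

Lemma sect2_1 : U 1 = 1.
Proof. by apply: fpsP => -[|n]. Qed.

Lemma fcoef_nat n f i : (n%:R * f)``_i = n%:R * f``_i.
Proof.
by rewrite !mulr_natl; elim: n => // n IHn; rewrite !mulrS fcoefD IHn.
Qed.

Lemma mulrnI_fps n f g : (0 < n)%N -> n%:R * f = n%:R * g -> f = g.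
Proof.
move=> n_gt0 fg; apply: fpsP => i; have := congr1 (fun h => h``_i) fg.
by rewrite !fcoef_nat; apply: mulfI; rewrite pnatr_eq0 -lt0n.
Qed.

(** The constant term equals its opposite, and every later coefficient is 0 or minus a coefficient
    of smaller index. *)
Lemma sub2_opp_eq0 f : f = - V f -> f = 0.
Proof.
move=> fV; apply: fpsP => n; elim/ltn_ind: n => n IHn; rewrite fV /=.
case: n => [|n] in IHn *.
  have := congr1 (fun h => h``_0) fV; rewrite /=; lia.
by case: ifP => // _; rewrite IHn ?oppr0 //; lia.
Qed.

(** * Congruences modulo q^n *)

Definition eqmod n f g := forall i, (i < n)%N -> f``_i = g``_i.

Lemma eqmod_sym n f g : eqmod n f g -> eqmod n g f.
Proof. by move=> fg i /fg. Qed.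

Lemma eqmod_trans n g f h : eqmod n f g -> eqmod n g h -> eqmod n f h.
Proof. by move=> fg gh i lt_in; rewrite fg ?gh. Qed.

Lemma eqmod_le n k f g : (k <= n)%N -> eqmod n f g -> eqmod k f g.
Proof. by move=> le_kn fg i lt_ik; apply/fg/leq_trans/le_kn. Qed.

Lemma eqmodD n f g f' g' :
  eqmod n f g -> eqmod n f' g' -> eqmod n (f + f') (g + g').
Proof. by move=> fg fg' i lt_in; rewrite !fcoefD fg ?fg'. Qed.

Lemma eqmodB n f g f' g' :
  eqmod n f g -> eqmod n f' g' -> eqmod n (f - f') (g - g').
Proof. by move=> fg fg' i lt_in; rewrite !fcoefB fg ?fg'. Qed.

Lemma eqmodM n f g f' g' :
  eqmod n f g -> eqmod n f' g' -> eqmod n (f * f') (g * g').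
Proof.
move=> fg fg' i lt_in; rewrite !fcoefM; apply: eq_bigr => j _.
by rewrite fg ?fg' //; have := ltn_ord j; lia.
Qed.

Lemma eqmodX n k f g : eqmod n f g -> eqmod n (f ^+ k) (g ^+ k).
Proof.
by move=> fg; elim: k => [|k IHk]; rewrite ?exprS //; apply: eqmodM.
Qed.

Lemma eqmodV n f g : eqmod n f g -> eqmod n (V f) (V g).
Proof. by move=> fg i lt_in /=; case: ifP => // _; apply: fg; lia. Qed.

Lemma eqmod_ext f g : (forall n, eqmod n f g) -> f = g.
Proof. by move=> fg; apply: fpsP => n; apply: fg (ltnSn n). Qed.

Lemma eqmodXn n k f : (n <= k)%N -> eqmod n (q ^+ k * f) 0.
Proof.
move=> le_nk i lt_in; rewrite fcoefM big1 // => j _.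
by rewrite fcoefXn ltn_eqF ?mul0r //; have := ltn_ord j; lia.
Qed.

Lemma eqmod_infprod (F : nat -> fps int) n N :
    (forall m, (0 < m)%N -> eqmod m (F m) 1) -> (n <= N.+1)%N ->
  eqmod n (fps_infprod F) (\prod_(1 <= m < N.+1) F m).
Proof.
move=> F1 le_nN i lt_in; apply: fps_infprodE; last by lia.
by move=> m j m_gt0 /(F1 _ m_gt0) ->; rewrite fcoef1.
Qed.

(** * Theta functions as products and as sums *)

(* Shanks' finite forms of Gauss's product formulas: the right-hand sides for n
   and n + 1 differ by a telescoping sum. *)
Lemma shanks_square (A : comUnitRingType) (r : A) n :
    (forall k, 1 + r ^+ k.+1 \is a GRing.unit) ->
  let e (k : nat) : A := (1 - r ^+ k.+1) / (1 + r ^+ k.+1) in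
  1 + 2 * \sum_(1 <= j < n.+1) (-1) ^+ j * r ^+ (j * j)
  = \prod_(0 <= k < n) e k
    + 2 * \sum_(1 <= s < n.+1)
            (-1) ^+ s * r ^+ (s * n.+1) * ((1 + r ^+ s)^-1 * \prod_(s <= k < n) e k).
Proof.
move=> r_unit e; elim: n => [|n IHn]; first by rewrite !big_nil ?mulr0.
rewrite big_nat_recr //= mulrDr addrA IHn {IHn}.
set z := r ^+ n.+1; set i' := (1 + z)^-1.
have hi' : i' * (1 + z) = 1 by rewrite mulVr ?r_unit.
have e_n : e n = (1 - z) * i' by [].
have aux (a i : A) : i * (1 + a) = 1 ->
    (a * ((1 - z) * i') - 1) * i = i' * (- z - (1 - a) * i).
  move=> hi; apply/eqP; rewrite -subr_eq0.
  have -> : (a * ((1 - z) * i') - 1) * i - i' * (- z - (1 - a) * i)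
    = i * (i' * (1 + z) - 1) - z * i' * (i * (1 + a) - 1) by ring.
  by rewrite hi hi' !subrr !mulr0 subrr.
(* Passing from [n] to [n.+1] multiplies each inner product by [e n], so a summand here is the
   change in the term of index [s]. The closed form of the partial sums is used at [k = n]. *)
have tele k : (k <= n)%N -> \sum_(1 <= s < k.+1)
    ((-1) ^+ s * (r ^+ (s * n.+2) * e n - r ^+ (s * n.+1))
       * ((1 + r ^+ s)^-1 * \prod_(s <= k < n) e k))
    = ((-1) ^+ k.+1 * z ^+ k.+1 * \prod_(k <= j < n) e j
       + z * \prod_(0 <= j < n) e j) * i'.
  elim: k => [|k IHk] le_kn.
    by rewrite [LHS]big_geq //; ring.
  rewrite big_nat_recr //= IHk ?(ltnW le_kn) // (big_ltn le_kn).
  set P := \prod_(k.+1 <= j < n) e j; set P0 := \prod_(0 <= j < n) e j.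
  rewrite /e -/(e n) e_n.
  set a := r ^+ k.+1; set i := (1 + a)^-1.
  have hi : i * (1 + a) = 1 by rewrite mulVr ?r_unit.
  have -> : r ^+ (k.+1 * n.+2) = z ^+ k.+1 * a.
    by rewrite -exprM -exprD; congr (_ ^+ _); lia.
  have -> : r ^+ (k.+1 * n.+1) = z ^+ k.+1.
    by rewrite -exprM; congr (_ ^+ _); lia.
  transitivity (((-1) ^+ k.+1 * z ^+ k.+1 * ((1 - a) * i * P) + z * P0) * i'
     + (-1) ^+ k.+1 * z ^+ k.+1 * P * ((a * ((1 - z) * i') - 1) * i)).
    ring.
  by rewrite (aux a i hi) [(-1) ^+ k.+2]exprS [z ^+ k.+2]exprS; ring.
pose S1 := \sum_(1 <= s < n.+1)
  (-1) ^+ s * r ^+ (s * n.+1) * ((1 + r ^+ s)^-1 * \prod_(s <= k < n) e k).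
pose S2 := \sum_(1 <= s < n.+1)
  (-1) ^+ s * r ^+ (s * n.+2) * ((1 + r ^+ s)^-1 * \prod_(s <= k < n.+1) e k).
set P0 := \prod_(0 <= k < n) e k.
rewrite -/S1; have -> : S1 = S2 - ((-1) ^+ n.+1 * z ^+ n.+1 + z * P0) * i'.
  have := tele n (leqnn n); rewrite [\prod_(n <= j < n) _]big_geq // mulr1 => <-.
  rewrite -sumrB; apply: eq_big_nat => s /andP[_ le_sn].
  by rewrite [\prod_(s <= k < n.+1) _]big_nat_recr //=; ring.
rewrite [\prod_(0 <= k < n.+1) _]big_nat_recr //= -/P0.
rewrite [\sum_(1 <= s < n.+2) _]big_nat_recr //= -/S2 big_geq // mulr1.
rewrite -/z -/i' e_n.
have -> : r ^+ (n.+1 * n.+1) = z ^+ n.+1 by rewrite -exprM.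
have -> : r ^+ (n.+1 * n.+2) = z ^+ n.+1 * z.
  by rewrite -exprM -exprD; congr (_ ^+ _); lia.
apply/eqP; rewrite -subr_eq0; set w := (-1) ^+ n.+1 * z ^+ n.+1.
rewrite [X in X == 0](_ : _ = (P0 + 2 * w) * (1 - i' * (1 + z))).
  by rewrite hi' subrr mulr0.
by rewrite /w; ring.
Qed.

Lemma shanks_triangular (A : comUnitRingType) (r : A) n :
    (forall k, 1 - r ^+ k.+1 \is a GRing.unit) ->
  let e (k : nat) : A := (1 - r ^+ k.*2.+2) / (1 - r ^+ k.*2.+1) in
  \sum_(0 <= j < n) (r ^+ (j * j.*2.+1) + r ^+ (j.+1 * j.*2.+1))
  = \sum_(0 <= s < n) r ^+ (s * n.*2.+1) * \prod_(s <= k < n) e k.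
Proof.
move=> r_unit e; elim: n => [|n IHn]; first by rewrite !big_nil.
rewrite big_nat_recr //= IHn {IHn}.
set z := r ^+ n.*2.+1; set i' := (1 - z)^-1.
have hi' : i' * (1 - z) = 1 by rewrite mulVr ?r_unit.
have e_n : e n = (1 - z * r) * i' by rewrite /e [r ^+ _.+2]exprSr.
have e_k k : e k * (1 - r ^+ k.*2.+1) = 1 - r ^+ k.*2.+2 by rewrite divrK ?r_unit.
have tele k : (k <= n)%N ->
    \sum_(0 <= s < k)
      ((r ^+ (s * n.*2.+3) * e n - r ^+ (s * n.*2.+1)) * \prod_(s <= k < n) e k)
    = \prod_(k <= j < n) e j * (1 - r ^+ k.*2) * z ^+ k * i'.
  elim: k => [|k IHk] le_kn; first by rewrite [LHS]big_geq // subrr mulr0 !mul0r.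
  rewrite big_nat_recr //= IHk ?(ltnW le_kn) // (big_ltn le_kn).
  set P := \prod_(k.+1 <= j < n) e j.
  rewrite e_n.
  have -> : r ^+ (k * n.*2.+3) = z ^+ k * r ^+ k.*2.
    by rewrite -exprM -exprD; congr (_ ^+ _); lia.
  have -> : r ^+ (k * n.*2.+1) = z ^+ k by rewrite -exprM; congr (_ ^+ _); lia.
  rewrite doubleS -e_k [z ^+ k.+1]exprS [r ^+ _.+1]exprS.
  set a := r ^+ k.*2; set b := z ^+ k; set ek := e k.
  transitivity (ek * P * (1 - a) * b * i' + b * a * (1 - z * r) * i' * ek * P
     - b * ek * P * (i' * (1 - z))); first by rewrite hi'; ring.
  ring.
pose S1 := \sum_(0 <= s < n) r ^+ (s * n.*2.+1) * \prod_(s <= k < n) e k.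
pose S2 := \sum_(0 <= s < n) r ^+ (s * n.*2.+3) * \prod_(s <= k < n.+1) e k.
rewrite -/S1; have -> : S1 = S2 - (1 - r ^+ n.*2) * z ^+ n * i'.
  have := tele n (leqnn n); rewrite [\prod_(n <= j < n) _]big_geq // mul1r => <-.
  rewrite -sumrB; apply: eq_big_nat => s /andP[_ lt_sn].
  by rewrite [\prod_(s <= k < n.+1) _]big_nat_recr ?(ltnW lt_sn) //=; ring.
rewrite [RHS]big_nat_recr //= -/S2 big_nat1.
rewrite e_n.
have -> : r ^+ (n * n.*2.+1) = z ^+ n by rewrite -exprM; congr (_ ^+ _); lia.
have -> : r ^+ (n.+1 * n.*2.+1) = z ^+ n * z.
  by rewrite -exprM -exprD; congr (_ ^+ _); lia.
have -> : r ^+ (n * n.*2.+3) = z ^+ n * r ^+ n.*2.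
  by rewrite -exprM -exprD; congr (_ ^+ _); lia.
have hz : r ^+ n.*2 * r = z by rewrite -exprSr.
transitivity (S2 - (1 - r ^+ n.*2) * z ^+ n * i'
    + z ^+ n * (1 + z) * (i' * (1 - z))); first by rewrite hi'; ring.
transitivity (S2 + z ^+ n * (r ^+ n.*2 - z * (r ^+ n.*2 * r)) * i'); last by ring.
by rewrite hz; ring.
Qed.

Lemma eqmod_onePXn n k h : (n <= k)%N -> eqmod n (1 + q ^+ k * h) 1.
Proof. by move=> le_nk; rewrite -{2}[1]addr0; apply/eqmodD/eqmodXn. Qed.

Lemma eqmod1_unit n f : eqmod n.+1 f 1 -> f \is a GRing.unit.
Proof. by move=> f1; rewrite fps_unitE f1 // unitr1. Qed.

Lemma eqmod_eq n f g : f = g -> eqmod n f g.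
Proof. by move=> ->. Qed.

Lemma eqmod1_inv n f : eqmod n f 1 -> eqmod n f^-1 1.
Proof.
case: n => [|n] // f1; rewrite -[f^-1]mulr1.
rewrite -[X in eqmod _ _ X](mulVr (eqmod1_unit f1)).
by apply: eqmodM => //; apply: eqmod_sym.
Qed.

Lemma eqmod1_div n f g : eqmod n f 1 -> eqmod n g 1 -> eqmod n (f / g) 1.
Proof. by move=> f1 /eqmod1_inv g1; rewrite -[1]mulr1; apply: eqmodM. Qed.

Lemma eqmod_sum0 n (I : eqType) (r : seq I) (F : I -> fps int) :
  (forall i, i \in r -> eqmod n (F i) 0) -> eqmod n (\sum_(i <- r) F i) 0.
Proof.
move=> F0; rewrite big_seq; elim/big_ind: _ => // f g f0 g0.
by rewrite -[0]addr0; apply: eqmodD.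
Qed.

Lemma eqmod_sub_scaledXn e n k : (n <= k)%N -> eqmod n (1 - (e * q) ^+ k) 1.
Proof. by rewrite exprMn mulrC -mulrN; apply: eqmod_onePXn. Qed.

Lemma eqmod_add_scaledXn e n k : (n <= k)%N -> eqmod n (1 + (e * q) ^+ k) 1.
Proof. by rewrite exprMn mulrC; apply: eqmod_onePXn. Qed.

Lemma eqmod_subXn n k : (n <= k)%N -> eqmod n (1 - q ^+ k) 1.
Proof. by rewrite -[X in X ^+ k]mul1r; apply: eqmod_sub_scaledXn. Qed.

Definition euler : fps int := fps_infprod (fun m => 1 - q ^+ m).

(* theta (-1) = phi(q) and theta 1 = phi(-q). *)
Definition theta e : fps int :=
  fps_infprod (fun m => (1 - (e * q) ^+ m) / (1 + (e * q) ^+ m)).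

Definition psi : fps int :=
  fps_infprod (fun m => (1 - q ^+ m.*2) / (1 - q ^+ m.*2.-1)).

Lemma euler_prod n : eqmod n.+1 euler (\prod_(0 <= k < n) (1 - q ^+ k.+1)).
Proof.
rewrite -(big_add1 _ _ 0 n.+1 xpredT (fun m => 1 - q ^+ m)).
by apply: eqmod_infprod => // m _; apply: eqmod_subXn.
Qed.

Lemma theta_prod e n : eqmod n.+1 (theta e)
  (\prod_(0 <= k < n) ((1 - (e * q) ^+ k.+1) / (1 + (e * q) ^+ k.+1))).
Proof.
rewrite -(big_add1 _ _ 0 n.+1 xpredT
            (fun m => (1 - (e * q) ^+ m) / (1 + (e * q) ^+ m))).
apply: eqmod_infprod => // m _.
by apply: eqmod1_div; [apply: eqmod_sub_scaledXn | apply: eqmod_add_scaledXn].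
Qed.

Lemma psi_prod n : eqmod n.+1 psi
  (\prod_(0 <= k < n) ((1 - q ^+ k.*2.+2) / (1 - q ^+ k.*2.+1))).
Proof.
rewrite -(big_add1 _ _ 0 n.+1 xpredT
            (fun m => (1 - q ^+ m.*2) / (1 - q ^+ m.*2.-1))).
by apply: eqmod_infprod => // m m_gt0; apply: eqmod1_div; apply: eqmod_subXn; lia.
Qed.

(** In the finite identity for r = e q, the terms s >= 1 on the product side are divisible by
    q^(s(n+1)), so only the product survives. *)
Lemma theta_sum e n : eqmod n.+1 (theta e)
  (1 + 2 * \sum_(1 <= j < n.+1) (-1) ^+ j * (e * q) ^+ (j * j)).
Proof.
rewrite shanks_square => [|k]; last first.
  exact/(@eqmod1_unit 0)/eqmod_add_scaledXn.
rewrite -[theta e]addr0; apply/eqmodD/eqmod_sym; first exact: theta_prod.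
rewrite big_distrr; apply: eqmod_sum0 => s; rewrite mem_index_iota => /andP[s_gt0 _].
set b := (1 + _)^-1 * _; rewrite exprMn [X in eqmod _ X](_ : _ = q ^+ (s * n.+1) *
  (2 * (-1) ^+ s * e ^+ (s * n.+1) * b)); last by rewrite /=; ring.
by apply: eqmodXn; rewrite leq_pmull.
Qed.

(** The exponents are the triangular numbers of index 2j and 2j + 1. In the finite identity the term
    s = 0 is the truncated product, and the others are divisible by a power of q beyond the
    precision. *)
Lemma psi_sum n : eqmod n psi
  (\sum_(0 <= j < n) (q ^+ (j * j.*2.+1) + q ^+ (j.+1 * j.*2.+1))).
Proof.
rewrite shanks_triangular => [|k]; last exact/(@eqmod1_unit 0)/eqmod_subXn.
case: n => [|n]; first by [].
rewrite big_ltn // expr0 mul1r -[psi]addr0.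
apply/eqmodD/eqmod_sym; first exact/eqmod_le/psi_prod.
apply: eqmod_sum0 => s; rewrite mem_index_iota => /andP[s_gt0 _].
by apply/eqmodXn/leq_trans/(leq_pmull _ s_gt0); lia.
Qed.

(** Even j = 2i give the squares 4 i^2, hence phi(q^4); odd j give the squares 8T + 1 with T
    triangular, hence q psi(q^8), with sign -e. One step of the induction adds four values of j, two
    of each parity. *)
Lemma theta_sum_dissection e n : e * e = 1 ->
  1 + 2 * \sum_(1 <= j < n.*2.*2.+1) (-1) ^+ j * (e * q) ^+ (j * j)
  = V (V (1 + 2 * \sum_(1 <= j < n.*2.+1) (-1) ^+ j * (-1 * q) ^+ (j * j)))
    - 2 * e * (q * V (V (V (\sum_(0 <= j < n)
                        (q ^+ (j * j.*2.+1) + q ^+ (j.+1 * j.*2.+1)))))).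
Proof.
move=> ee; have sqr_term e' j : e' * e' = 1 -> (-1) ^+ j * (e' * q) ^+ (j * j)
    = (if odd j then - e' else 1) * q ^+ (j * j).
  move=> ee'; rewrite -signr_odd exprMn mulrA; congr (_ * _).
  rewrite -[X in e' ^+ X]odd_double_half oddM andbb exprD -mul2n exprM expr2 ee'.
  by rewrite expr1n mulr1; case: (odd j); rewrite /= ?mulN1r ?mul1r.
elim: n => [|n IHn].
  by rewrite !big_nil !mulr0 !addr0 !rmorph1 !rmorph0 !mulr0 subr0.
have recr m (F : nat -> fps int) : \sum_(1 <= j < m.+3) F j
    = \sum_(1 <= j < m.+1) F j + (F m.+1 + F m.+2).
  by rewrite 2?big_nat_recr //= addrA.
rewrite !doubleS !recr [\sum_(0 <= j < n.+1) _]big_nat_recr //=.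
set A := \sum_(1 <= j < n.*2.*2.+1) _ in IHn *.
set B := \sum_(1 <= j < n.*2.+1) _ in IHn *.
set C := \sum_(0 <= j < n) _ in IHn *.
rewrite !sqr_term //=; try by rewrite mulrNN mulr1.
rewrite !odd_double /= -addrA mulrDr addrA IHn.
have VXn k : V (q ^+ k) = q ^+ k.*2 by rewrite sub2_exp sub2X -exprM mul2n.
rewrite opprK !mul1r !(VXn, sub2E).
have -> : q ^+ (n.*2.*2.+1 * n.*2.*2.+1) = q * q ^+ (n * n.*2.+1).*2.*2.*2.
  by rewrite -exprS; congr (_ ^+ _); lia.
have -> : q ^+ (n.*2.*2.+3 * n.*2.*2.+3) = q * q ^+ (n.+1 * n.*2.+1).*2.*2.*2.
  by rewrite -exprS; congr (_ ^+ _); lia.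
have -> : (n.*2.*2.+2 * n.*2.*2.+2 = (n.*2.+1 * n.*2.+1).*2.*2)%N by lia.
have -> : (n.*2.*2.+4 * n.*2.*2.+4 = (n.*2.+2 * n.*2.+2).*2.*2)%N by lia.
ring.
Qed.

Lemma theta_dissection e : e * e = 1 ->
  theta e = V (V (theta (-1))) - 2 * e * (q * V (V (V psi))).
Proof.
move=> ee; apply: eqmod_ext => n.
have le_n2 : (n <= n.*2.+1)%N by lia.
have le_n4 : (n <= n.*2.*2.+1)%N by lia.
have := eqmod_le le_n4 (@theta_sum e n.*2.*2).
rewrite theta_sum_dissection // => /eqmod_trans; apply; apply: eqmodB.
  by apply/eqmodV/eqmodV/eqmod_sym/eqmod_le/theta_sum.
apply: eqmodM => //; apply: eqmodM => //.
exact/eqmodV/eqmodV/eqmodV/eqmod_sym/psi_sum.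
Qed.

(** * Theta functions as eta quotients *)

Lemma subXn_unit k : 1 - q ^+ k.+1 \is a GRing.unit.
Proof. exact/(@eqmod1_unit 0)/eqmod_subXn. Qed.

Lemma add_scaledXn_unit e k : 1 + (e * q) ^+ k.+1 \is a GRing.unit.
Proof. exact/(@eqmod1_unit 0)/eqmod_add_scaledXn. Qed.

(** Factor by factor, (1 - z) / (1 + z) * (1 - z^2) = (1 - z)^2 with z = q^m. *)
Lemma theta_euler : theta 1 * V euler = euler ^+ 2.
Proof.
apply: eqmod_ext => n; apply/(eqmod_le (leqnSn n)).
have := eqmodM (@theta_prod 1 n) (eqmodV (@euler_prod n)).
move=> /eqmod_trans; apply; apply: eqmod_trans (eqmod_sym (eqmodX 2 (@euler_prod n))).
rewrite (rmorph_prod V) expr2 -!big_split /=.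
rewrite (eq_bigr (fun k => (1 - q ^+ k.+1) * (1 - q ^+ k.+1))) // => k _.
have := add_scaledXn_unit 1 k.
rewrite mul1r sub2B sub2_1 sub2_exp sub2X -exprM mul2n => u.
apply: (mulIr u); rewrite mulrAC divrK //.
by rewrite -muln2 exprM; ring.
Qed.

(** Truncating [euler] at twice the length of [psi], its odd factors cancel the denominators and its
    even factors double the numerators. *)
Lemma psi_euler : psi * euler = V euler ^+ 2.
Proof.
apply: eqmod_ext => n; apply/(eqmod_le (leqnSn n)).
have euler_2n : eqmod n.+1 euler (\prod_(0 <= k < n.*2) (1 - q ^+ k.+1)).
  by apply: eqmod_le (@euler_prod _); lia.
have := eqmodM (@psi_prod n) euler_2n.
move=> /eqmod_trans; apply.
apply: eqmod_trans (eqmod_sym (eqmodX 2 (eqmodV (@euler_prod n)))).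
rewrite (rmorph_prod V) expr2 -!big_split /=.
rewrite [X in eqmod _ _ X](_ : _ = \prod_(0 <= k < n)
  ((1 - q ^+ k.*2.+2) * (1 - q ^+ k.*2.+2))); last first.
  by apply: eq_bigr => k _; rewrite sub2B sub2_1 sub2_exp sub2X -exprM mul2n doubleS.
rewrite [X in eqmod _ X](_ : _ = \prod_(0 <= k < n)
  ((1 - q ^+ k.*2.+2) * (1 - q ^+ k.*2.+2))) //.
elim: n {euler_2n} => [|n IHn]; first by rewrite !big_nil mulr1.
rewrite doubleS [\prod_(0 <= k < n.*2.+2) _]big_nat_recr //=
  [\prod_(0 <= k < n.*2.+1) _]big_nat_recr //=
  [X in X * _]big_nat_recr //= [RHS]big_nat_recr //= -IHn.
set e := 1 - q ^+ n.*2.+1; set f := 1 - q ^+ n.*2.+2.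
set A := \prod_(0 <= k < n) _; set B := \prod_(0 <= k < n.*2) _.
transitivity (A * B * (f / e * e) * f); first by ring.
by rewrite divrK ?subXn_unit //; ring.
Qed.

(** Factors of odd index are inverse to each other in the two products, as (-q)^m = - q^m; those of
    even index agree and are the factors of [V (theta 1)]. *)
Lemma theta_neg_mul : theta (-1) * theta 1 = V (theta 1) ^+ 2.
Proof.
apply: eqmod_ext => n; apply/(eqmod_le (leqnSn n)).
have theta_2n e : eqmod n.+1 (theta e) (\prod_(0 <= k < n.*2)
    ((1 - (e * q) ^+ k.+1) / (1 + (e * q) ^+ k.+1))).
  by apply: eqmod_le (@theta_prod _ _); lia.
have := eqmodM (theta_2n (-1)) (theta_2n 1).
move=> /eqmod_trans; apply.
apply: eqmod_trans (eqmod_sym (eqmodX 2 (eqmodV (@theta_prod 1 n)))).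
rewrite (rmorph_prod V) expr2 -!big_split /=.
apply: eqmod_eq; elim: n {theta_2n} => [|n IHn]; first by rewrite !big_nil.
rewrite doubleS [LHS]big_nat_recr //= [\prod_(0 <= k < n.*2.+1) _]big_nat_recr //=.
rewrite [RHS]big_nat_recr //= -IHn -!mulrA; congr (_ * _).
have u1 : 1 - q ^+ n.*2.+1 \is a GRing.unit := subXn_unit _.
have u2 : 1 + q ^+ n.*2.+1 \is a GRing.unit.
  by rewrite -[X in X ^+ _]mul1r add_scaledXn_unit.
have odd_pow : (-1 * q) ^+ n.*2.+1 = - q ^+ n.*2.+1.
  by rewrite mulN1r exprNn -signr_odd /= odd_double mulN1r.
have even_pow : (-1 * q) ^+ n.*2.+2 = q ^+ n.*2.+2.
  by rewrite mulN1r exprNn -signr_odd /= odd_double mul1r.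
rewrite !mul1r odd_pow even_pow opprK.
have u3 : 1 + q ^+ n.+1 \is a GRing.unit.
  by rewrite -[X in X ^+ _]mul1r add_scaledXn_unit.
have Vf : V ((1 - q ^+ n.+1) / (1 + q ^+ n.+1))
    = (1 - q ^+ n.*2.+2) / (1 + q ^+ n.*2.+2).
  by rewrite sub2M (sub2_inv u3) !sub2E sub2X -exprM mul2n doubleS.
by rewrite Vf mulKr // mulVKr // -!mulrA.
Qed.

Lemma theta_unit e : theta e \is a GRing.unit.
Proof. by apply: (@eqmod1_unit 0); have := @theta_prod e 0; rewrite big_nil. Qed.

Lemma euler_unit : euler \is a GRing.unit.
Proof. by apply: (@eqmod1_unit 0); have := @euler_prod 0; rewrite big_nil. Qed.

HB.lock Definition phi : fps int := theta (-1).
HB.lock Definition phiN : fps int := theta 1.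
Notation iphiN := phiN^-1.
Notation ieuler := euler^-1.

Lemma phiNV : phiN * iphiN = 1.
Proof. by rewrite mulrV // phiN.unlock theta_unit. Qed.

Lemma eulerV : euler * ieuler = 1.
Proof. exact: mulrV euler_unit. Qed.

Lemma sub2_mul_eq1 f g : f * g = 1 -> V f * V g = 1.
Proof. by rewrite -sub2M => ->; apply: sub2_1. Qed.

Lemma phi_mul_phiN : phi * phiN = V phiN ^+ 2.
Proof. by rewrite phi.unlock phiN.unlock theta_neg_mul. Qed.

Lemma phiE : phi = V (V phi) + 2 * (q * V (V (V psi))).
Proof. by rewrite phi.unlock {1}theta_dissection; [ring | rewrite mulrNN mulr1]. Qed.

Lemma phiNE : phiN = V (V phi) - 2 * (q * V (V (V psi))).
Proof. by rewrite phi.unlock phiN.unlock theta_dissection ?mulr1. Qed.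

Lemma phiN_euler : phiN = euler ^+ 2 * V ieuler.
Proof. by rewrite phiN.unlock -theta_euler -mulrA (sub2_mul_eq1 eulerV) mulr1. Qed.

Lemma psi_eulerE : psi = V euler ^+ 2 * ieuler.
Proof. by rewrite -psi_euler -mulrA eulerV mulr1. Qed.

Lemma iphiN_euler : iphiN = V euler * ieuler ^+ 2.
Proof.
have u : phiN \is a GRing.unit by rewrite phiN.unlock theta_unit.
apply: (mulrI u); rewrite phiNV phiN_euler.
transitivity ((V euler * V ieuler) * (euler * ieuler) ^+ 2); last by ring.
by rewrite (sub2_mul_eq1 eulerV) eulerV !expr1n mulr1.
Qed.

Lemma phi_euler : phi = V euler ^+ 5 * V (V ieuler) ^+ 2 * ieuler ^+ 2.
Proof.
have -> : phi = V phiN ^+ 2 * iphiN.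
  by rewrite -phi_mul_phiN -mulrA phiNV mulr1.
by rewrite {1}phiN_euler iphiN_euler !sub2E; ring.
Qed.

(** Both sides equal f_2^4 / f_1^2. *)
Lemma psi_sqr : psi ^+ 2 = V psi * phi.
Proof.
rewrite phi_euler psi_eulerE !sub2E.
transitivity (V euler ^+ 4 * ieuler ^+ 2 * (V euler * V ieuler)
  * (V (V euler) * V (V ieuler)) ^+ 2); last by ring.
by rewrite !(sub2_mul_eq1, eulerV) // expr1n; ring.
Qed.

Lemma psi_sqrVV : V (V psi) ^+ 2 = V (V (V psi)) * V (V phi).
Proof. by rewrite -!sub2_exp psi_sqr !sub2M. Qed.

Lemma phi_sqr : phi ^+ 2 = V phi ^+ 2 + 4 * (q * V (V psi) ^+ 2).
Proof.
(* The dissection of phi gives E(q) = - E(q^2). *)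
pose E := phi ^+ 2 - V phi ^+ 2 - 4 * (q * V (V psi) ^+ 2).
suff /eqP : E = 0 by rewrite /E -addrA -opprD subr_eq0 => /eqP.
apply: sub2_opp_eq0; rewrite /E.
(* By [psi_sqrVV], the cross term of the squared dissection cancels the last term of [E]; what
   remains is [- V E]. *)
by rewrite {1}phiE !sub2E sub2X psi_sqrVV; ring.
Qed.

Lemma phiN_sqr : phiN ^+ 2 = V phi ^+ 2 - 4 * (q * V (V psi) ^+ 2).
Proof.
transitivity (phi ^+ 2 - 8 * (q * V (V psi) ^+ 2)); last by rewrite phi_sqr; ring.
by rewrite phiNE [X in _ = X ^+ 2 - _]phiE psi_sqrVV; ring.
Qed.

(** * Modular equations *)

(* x and t are the Hauptmoduln eta(4 tau)^8 / eta(tau)^8 of Gamma_0(4) and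
   eta(2 tau)^24 / eta(tau)^24 of Gamma_0(2); y is one of Gamma_0(8). *)
HB.lock Definition y : fps int := q * V (V psi) ^+ 2 * iphiN ^+ 2.
HB.lock Definition x : fps int := y * (1 + 4 * y).
HB.lock Definition t : fps int := x * (1 + 16 * x).
HB.lock Definition v : fps int := phi * V iphiN.
HB.lock Definition w : fps int := phiN * V iphiN.
HB.lock Definition c : fps int := V phi * iphiN.

Lemma phi_phiN : phi * phiN * V iphiN ^+ 2 = 1.
Proof.
by rewrite phi_mul_phiN -exprMn (sub2_mul_eq1 phiNV) expr1n.
Qed.

Lemma vw : v * w = 1.
Proof. by rewrite -[RHS]phi_phiN v.unlock w.unlock; ring. Qed.

(** The odd parts of [phi] and [phiN] are opposite. Together with [vw], this makes [v] and [w] the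
    roots of Z^2 - 2 (V c) Z + 1. *)
Lemma vDw : v + w = 2 * V c.
Proof. by rewrite v.unlock w.unlock c.unlock phiNE {1}phiE sub2M; ring. Qed.

Lemma v_sqr : v ^+ 2 = phi * iphiN.
Proof.
transitivity ((phi * phiN * V iphiN ^+ 2) * (phi * iphiN)); last first.
  by rewrite phi_phiN mul1r.
transitivity (v ^+ 2 * (phiN * iphiN)); first by rewrite phiNV mulr1.
by rewrite v.unlock; ring.
Qed.

(** The difference of [phi_sqr] and [phiN_sqr], divided by phi(-q)^2. *)
Lemma y8E : 1 + 8 * y = v ^+ 4.
Proof.
rewrite (exprM v 2 2) v_sqr exprMn phi_sqr.
transitivity ((phiN * iphiN) ^+ 2 + 8 * y); first by rewrite phiNV expr1n.
by rewrite [(phiN * _) ^+ 2]exprMn phiN_sqr y.unlock; ring.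
Qed.

Lemma c_sqr : c ^+ 2 = 1 + 4 * y.
Proof.
transitivity ((phiN * iphiN) ^+ 2 + 4 * y); last by rewrite phiNV expr1n.
by rewrite [(phiN * _) ^+ 2]exprMn phiN_sqr c.unlock y.unlock; ring.
Qed.

Lemma x16E : 1 + 16 * x = v ^+ 8.
Proof. by rewrite (exprM v 4 2) -y8E x.unlock; ring. Qed.

(** As x = y c^2, [psi_sqrVV] gives V x = q^2 psi(q^4)^4 / phi(-q^2)^4; the factor v^4 then turns
    phi(-q^2)^4 into phi(-q)^4. *)
Lemma y_sqr : y ^+ 2 = V x * (1 + 8 * y).
Proof.
have -> : V x = q ^+ 2 * V (V psi) ^+ 4 * V iphiN ^+ 4.
  rewrite x.unlock -c_sqr y.unlock c.unlock !sub2E sub2X.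
  transitivity (q ^+ 2 * (V (V psi) ^+ 2) ^+ 2 * V iphiN ^+ 4); last by ring.
  by rewrite psi_sqrVV; ring.
rewrite y8E v.unlock.
have im : phi * V iphiN ^+ 2 = iphiN.
  transitivity (phi * V iphiN ^+ 2 * (phiN * iphiN)); first by rewrite phiNV mulr1.
  transitivity (phi * phiN * V iphiN ^+ 2 * iphiN); first by ring.
  by rewrite phi_phiN mul1r.
rewrite [RHS](_ : _ = q ^+ 2 * V (V psi) ^+ 4 * (phi * V iphiN ^+ 2) ^+ 4).
  by rewrite im y.unlock; ring.
by ring.
Qed.

(** Square x = y (1 + 4y), eliminate y^2 by [y_sqr], and use (1 + 8y)^2 = 1 + 16x. Thus [x] is
    quadratic over series in q^2, which yields the recurrence [sect2_xx]. *)
Lemma x_sqr : x ^+ 2 = V t * (1 + 16 * x).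
Proof.
have -> : 1 + 16 * x = (1 + 8 * y) ^+ 2 by rewrite x.unlock; ring.
transitivity (V x * (1 + 8 * y) * (1 + 8 * y + 16 * (V x * (1 + 8 * y)))).
  by rewrite -y_sqr x.unlock; ring.
by rewrite t.unlock !sub2E; ring.
Qed.

Lemma sect2_v : U v = c.
Proof.
rewrite (_ : v = V c * 1 + q * V (2 * (V (V psi) * iphiN))).
  by rewrite sect2D sect2M sect2XM sect2_1 mulr1 addr0.
by rewrite v.unlock c.unlock {1}phiE !sub2E; ring.
Qed.

Lemma sect2_w : U w = c.
Proof.
rewrite (_ : w = V c * 1 - q * V (2 * (V (V psi) * iphiN))).
  by rewrite sect2B sect2M sect2XM sect2_1 mulr1 subr0.
by rewrite w.unlock c.unlock phiNE !sub2E; ring.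
Qed.

(** Apply [U] to v^k times v^2 = 2 (V c) v - 1. This is the Chebyshev recurrence: U(v^k) =
    T_k(c). *)
Lemma sect2_v_rec k : U (v ^+ k.+2) = 2 * c * U (v ^+ k.+1) - U (v ^+ k).
Proof.
rewrite (_ : v ^+ k.+2 = 2 * (V c * v ^+ k.+1) - v ^+ k).
  by rewrite sect2B sect2_nat sect2M mulrA.
rewrite mulrA -vDw mulrDl [w * _]mulrC -exprS.
have -> : v ^+ k.+1 * w = v ^+ k * (v * w) by rewrite exprS; ring.
by rewrite vw mulr1; ring.
Qed.

Lemma sect2_v2 : U (v ^+ 2) = 1 + 8 * y.
Proof. by rewrite sect2_v_rec expr1 expr0 sect2_1 sect2_v -mulrA -expr2 c_sqr; ring. Qed.

Lemma sect2_v3 : U (v ^+ 3) = c * (1 + 16 * y).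
Proof. by rewrite sect2_v_rec sect2_v2 expr1 sect2_v; ring. Qed.

Lemma sect2_v4 : U (v ^+ 4) = 1 + 32 * x.
Proof.
rewrite sect2_v_rec sect2_v3 sect2_v2.
transitivity (2 * c ^+ 2 * (1 + 16 * y) - (1 + 8 * y)); first by ring.
by rewrite c_sqr x.unlock; ring.
Qed.

Lemma sect2_y : U y = 4 * x.
Proof.
apply: (@mulrnI_fps 8 _ _ isT); rewrite -[LHS](sect2_nat 8).
rewrite (_ : 8 * y = v ^+ 4 - 1); last by rewrite -y8E; ring.
by rewrite sect2B sect2_v4 sect2_1; ring.
Qed.

(** Modulo [y_sqr], a polynomial in [y] is affine in [y] over series in q^2, so [U 1] and [U y]
    determine its section. *)
Lemma sect2_x : U x = 8 * t.
Proof.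
rewrite (_ : x = y + 4 * (V x * (1 + 8 * y))); last by rewrite -y_sqr x.unlock; ring.
by rewrite sect2D sect2_nat sect2M sect2D sect2_nat sect2_1 sect2_y t.unlock; ring.
Qed.

Lemma sect2_xy : U (x * y) = x + 80 * x ^+ 2 + 1024 * x ^+ 3.
Proof.
rewrite (_ : x * y = V x * (1 + 12 * y + 32 * (V x * (1 + 8 * y)))).
  by rewrite !(sect2D, sect2M, sect2_nat) sect2_1 sect2_y; ring.
rewrite -y_sqr; transitivity (y ^+ 2 * (1 + 4 * y)); first by rewrite x.unlock; ring.
by rewrite [in LHS]y_sqr; ring.
Qed.

Lemma sect2_xx f : U (x ^+ 2 * f) = t * (U f + 16 * U (x * f)).
Proof.
rewrite x_sqr (_ : V t * _ * f = V t * (f + 16 * (x * f))); last by ring.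
by rewrite sect2M sect2D sect2_nat.
Qed.

Lemma sect2_v5 : U (v ^+ 5) = c * (1 + 48 * y + 256 * y ^+ 2).
Proof. by rewrite sect2_v_rec sect2_v4 sect2_v3 x.unlock; ring. Qed.

Lemma sect2_v6 : U (v ^+ 6) = (1 + 8 * y) * (1 + 64 * y + 256 * y ^+ 2).
Proof.
rewrite sect2_v_rec sect2_v5 sect2_v4.
transitivity (2 * c ^+ 2 * (1 + 48 * y + 256 * y ^+ 2) - (1 + 32 * x)); first by ring.
by rewrite c_sqr x.unlock; ring.
Qed.

Lemma sect2_v7 :
  U (v ^+ 7) = c * (1 + 96 * y + 1280 * y ^+ 2 + 4096 * y ^+ 3).
Proof. by rewrite sect2_v_rec sect2_v6 sect2_v5; ring. Qed.

Lemma sect2_v8 : U (v ^+ 8) = 1 + 128 * t.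
Proof. by rewrite -x16E sect2D sect2_1 sect2_nat sect2_x; ring. Qed.

Lemma sect2_v9 : U (v ^+ 9) =
  c * (1 + 16 * (10 * y + 240 * y ^+ 2 + 1792 * y ^+ 3 + 4096 * y ^+ 4)).
Proof. by rewrite sect2_v_rec sect2_v8 sect2_v7 t.unlock x.unlock; ring. Qed.

(** Since 16x = v^8 - 1, one has 16 x v = v^9 - v, and likewise 16 x w = v^7 - w. The results are
    arranged in terms of [x] and [2 * y], the generators of [lattice] below. *)
Lemma sect2_xv : U (x * v) = c * (12 * x + 256 * x ^+ 2 - 2 * y * (1 + 32 * x)).
Proof.
apply: (@mulrnI_fps 16 _ _ isT); rewrite -[LHS](sect2_nat 16).
transitivity (U (v ^+ 9 - v)); first by congr (U _); rewrite exprS -x16E; ring.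
by rewrite sect2B sect2_v sect2_v9 x.unlock; ring.
Qed.

Lemma sect2_xw : U (x * w) = c * (4 * x + 2 * y * (1 + 32 * x)).
Proof.
apply: (@mulrnI_fps 16 _ _ isT); rewrite -[LHS](sect2_nat 16).
transitivity (U (v ^+ 7 - w)); last first.
  by rewrite sect2B sect2_w sect2_v7 x.unlock; ring.
congr (U _); transitivity ((1 + 16 * x) * w - w); first by ring.
by rewrite x16E exprSr -mulrA vw mulr1.
Qed.

(** * Integrality with respect to X = 8x *)

(** The Z[X]-module generated by [gen], given inductively so that statements linear in the element
    reduce to generators. *)
Inductive span (X : fps int) (gen : fps int -> Prop) : fps int -> Prop :=
| span_gen f : gen f -> span X gen f
| span_sub f g : span X gen f -> span X gen g -> span X gen (f - g)
| span_mul f : span X gen f -> span X gen (X * f).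

Lemma span_add X gen f g : span X gen f -> span X gen g -> span X gen (f + g).
Proof.
move=> Sf Sg; have -> : f + g = f - ((g - g) - g) by ring.
by do 3?apply: span_sub.
Qed.

Lemma span_nat X gen k f : span X gen f -> span X gen (k%:R * f).
Proof.
move=> Sf; elim: k => [|k IHk].
  by rewrite mul0r -(subrr f); apply: span_sub.
by rewrite mulrS mulrDl mul1r; apply: span_add.
Qed.

Notation X := (8 * x).

Definition powX : fps int -> Prop := span X (fun f => f = X).

(** The module x Z[X] + 2y Z[X]. A first section yields c times an element of it, and a second one
    leads back to X Z[X]. *)
Definition lattice : fps int -> Prop := span X (fun f => f = x \/ f = 2 * y).

Lemma span_8t gen f : span X gen f -> span X gen (8 * t * f).
Proof.
move=> Sf; rewrite (_ : _ * f = X * f + 2 * (X * (X * f))).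
  by apply: span_add; last apply: span_nat; do ?apply: span_mul.
by rewrite t.unlock; ring.
Qed.

Lemma powX_X : powX X.
Proof. exact: span_gen. Qed.

Lemma powX_8t : powX (8 * t).
Proof.
rewrite (_ : 8 * t = X + 2 * (X * X)); last by rewrite t.unlock; ring.
by apply: span_add; last apply/span_nat/span_mul; apply: powX_X.
Qed.

Lemma lattice_x : lattice x.
Proof. by apply: span_gen; left. Qed.

Lemma lattice_2y : lattice (2 * y).
Proof. by apply: span_gen; right. Qed.

Lemma lattice_t : lattice t.
Proof.
rewrite (_ : t = x + 2 * (X * x)); last by rewrite t.unlock; ring.
by apply: span_add; last apply/span_nat/span_mul; apply: lattice_x.
Qed.

(* The second component feeds the order-two recurrence sect2_xx, whose
   coefficients become polynomials in X because 8 t = X + 2 X^2. *)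
Lemma sect2_lattice f : lattice f -> powX (U f) /\ powX (U (X * f)).
Proof.
elim=> {f} [f [] ->|f g _ [IHf IHXf] _ [IHg IHXg]|f _ [IHf IHXf]].
- split; first by rewrite sect2_x; apply: powX_8t.
  rewrite (_ : X * x = 8 * (x ^+ 2 * 1)); last by ring.
  rewrite sect2_nat sect2_xx sect2_1 mulr1 sect2_x.
  rewrite (_ : 8 * _ = 8 * t + 16 * (8 * t * (8 * t))); last by ring.
  by apply: span_add; last apply/span_nat/span_8t; apply: powX_8t.
- split; first by rewrite sect2_nat sect2_y mulrA -natrM; apply: powX_X.
  rewrite (_ : X * (2 * y) = 16 * (x * y)); last by ring.
  rewrite sect2_nat sect2_xy.
  rewrite (_ : 16 * _ = 2 * X + (20 * (X * X) + 32 * (X * (X * X)))); last by ring.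
  by do ?apply: span_add; apply: span_nat; do ?apply: span_mul; apply: powX_X.
- rewrite mulrBr !sect2B; split; exact: span_sub.
split=> //; rewrite (_ : X * (X * f) = 64 * (x ^+ 2 * f)); last by ring.
rewrite sect2_nat sect2_xx.
rewrite (_ : 64 * _ = 8 * t * (8 * U f) + 16 * (8 * t * (8 * U (x * f)))); last by ring.
have -> : 8 * U (x * f) = U (X * f) by rewrite -sect2_nat mulrA.
by apply: span_add; last apply: span_nat; apply: span_8t => //; apply: span_nat.
Qed.

Lemma sect2_xv_lattice : exists2 B, lattice B & U (x * v) = c * B.
Proof.
exists (12 * x + 32 * (X * x) - (2 * y + 4 * (X * (2 * y)))).
  apply: span_sub; apply: span_add.
  - exact/span_nat/lattice_x.
  - exact/span_nat/span_mul/lattice_x.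
  - exact: lattice_2y.
  - exact/span_nat/span_mul/lattice_2y.
by rewrite sect2_xv; ring.
Qed.

Lemma sect2_xw_lattice : exists2 B, lattice B & U (x * w) = c * B.
Proof.
exists (4 * x + (2 * y + 4 * (X * (2 * y)))).
  apply: span_add; first exact/span_nat/lattice_x.
  by apply: span_add; last apply/span_nat/span_mul; apply: lattice_2y.
by rewrite sect2_xw; ring.
Qed.

Lemma sect2_x2 f B : lattice B -> U f = c -> U (x * f) = c * B ->
  exists2 B', lattice B' & U (x ^+ 2 * f) = c * B'.
Proof.
move=> LB Uf Uxf; exists (t + 2 * (8 * t * B)).
  by apply: span_add lattice_t _; apply/span_nat/span_8t.
by rewrite sect2_xx Uf Uxf; ring.
Qed.

(** The first step: v^7 stems from the factor phi(-q)^-7 of the generating function, and v^7 = v^8 w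
    = (1 + 16x) w. *)
Lemma sect2_base : exists2 B, lattice B & U (x * v ^+ 7) = c * B.
Proof.
have [B LB UB] := sect2_xw_lattice; have [B2 LB2 UB2] := sect2_x2 LB sect2_w UB.
exists (B + 16 * B2); first by apply: span_add => //; apply: span_nat.
have -> : x * v ^+ 7 = x * w + 16 * (x ^+ 2 * w).
  transitivity (x * (v ^+ 7 * (v * w))); first by rewrite vw mulr1.
  by rewrite (mulrA _ v) -exprSr -x16E; ring.
by rewrite sect2D sect2_nat UB UB2; ring.
Qed.

Lemma sect2_XX f B B' : U f = 8 * (c * B) -> U (X * f) = 8 * (c * B') ->
  U (X * (X * f)) = 8 * (c * (8 * t * (8 * B + 16 * B'))).
Proof.
move=> Uf UXf; rewrite (_ : X * (X * f) = 64 * (x ^+ 2 * f)); last by ring.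
rewrite sect2_nat sect2_xx.
transitivity (64 * t * U f + 8 * 16 * t * (8 * U (x * f))); first by ring.
by rewrite -(sect2_nat 8) (mulrA 8) Uf UXf; ring.
Qed.

(** The source of the factor 8 gained at each later step. The exponent is 9 = 7 + 2 because the
    prefactor of G_(a+1) is v^2 G_0. The claims for [Q] and [X * Q] are carried together as data of
    the order-two recurrence [sect2_XX]. *)
Lemma sect2_powX Q : powX Q ->
  (exists2 B, lattice B & U (x * Q * v ^+ 9) = 8 * (c * B)) /\
  (exists2 B, lattice B & U (x * (X * Q) * v ^+ 9) = 8 * (c * B)).
Proof.
have v9 f : f * v ^+ 9 = f * v + 16 * (x * f * v) by rewrite exprS -x16E; ring.
have [B1 LB1 UB1] := sect2_xv_lattice.
have [B2 LB2 UB2] := sect2_x2 LB1 sect2_v UB1.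
(* The recurrence multiplies by t; [lattice] is known to be stable only under 8t, so a factor 8 is
   kept with the section. *)
pose B3 := 8 * t * (B1 + 16 * B2).
have LB3 : lattice B3 by apply/span_8t/span_add => //; apply: span_nat.
have UB3 : 8 * U (x ^+ 3 * v) = c * B3.
  rewrite (_ : x ^+ 3 * v = x ^+ 2 * (x * v)); last by ring.
  by rewrite sect2_xx [x * (x * v)]mulrA -expr2 UB1 UB2 /B3; ring.
pose B4 := 8 * t * (B2 + 2 * B3).
have LB4 : lattice B4 by apply/span_8t/span_add => //; apply: span_nat.
have UB4 : 8 * U (x ^+ 4 * v) = c * B4.
  rewrite (_ : x ^+ 4 * v = x ^+ 2 * (x ^+ 2 * v)); last by ring.
  rewrite sect2_xx [x * (_ * v)]mulrA -exprS UB2.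
  transitivity (8 * (t * (c * B2)) + 16 * t * (8 * U (x ^+ 3 * v))); first by ring.
  by rewrite UB3 /B4; ring.
elim=> {Q} [Q ->|f g _ [[Bf Lf Uf] [Bf' Lf' Uf']] _ [[Bg Lg Ug] [Bg' Lg' Ug']]
           |f _ [[Bf Lf Uf] [Bf' Lf' Uf']]].
- split.
    exists (B2 + 2 * B3); first by apply: span_add => //; apply: span_nat.
    rewrite v9 (_ : _ + _ = 8 * (x ^+ 2 * v) + 16 * (8 * (x ^+ 3 * v))); last by ring.
    by rewrite sect2D !sect2_nat UB2 UB3; ring.
  exists (B3 + 16 * B4); first by apply: span_add => //; apply: span_nat.
  rewrite v9 (_ : _ + _ = 8 * (8 * (x ^+ 3 * v)) + 16 * (8 * (8 * (x ^+ 4 * v)))).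
    by rewrite sect2D !sect2_nat UB3 UB4; ring.
  by ring.
- split.
    exists (Bf - Bg); first exact: span_sub.
    by rewrite mulrBr mulrBl sect2B Uf Ug; ring.
  exists (Bf' - Bg'); first exact: span_sub.
  by rewrite !mulrBr mulrBl sect2B Uf' Ug'; ring.
split; first by exists Bf'.
exists (8 * t * (8 * Bf + 16 * Bf')).
  by apply/span_8t/span_add; apply: span_nat.
rewrite (_ : x * (X * (X * f)) * v ^+ 9 = X * (X * (x * f * v ^+ 9))); last by ring.
have UXf : U (X * (x * f * v ^+ 9)) = 8 * (c * Bf').
  by rewrite -[RHS]Uf'; congr (U _); ring.
exact: sect2_XX Uf UXf.
Qed.

(** Supplies the last factor 8: [diamond_sectE] extracts only 8^alpha from alpha + 1 double
    sections. *)
Lemma powX_dvd8 f : powX f -> exists g, f = 8 * g.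
Proof.
elim=> {f} [f ->|f g _ [f' ->] _ [g' ->]|f _ [f' ->]].
- by exists x.
- by exists (f' - g'); rewrite mulrBr.
by exists (X * f'); ring.
Qed.

(** * One double section, from G_a to G_(a+1) *)

Lemma x_euler : x = q * V (V euler) ^+ 8 * ieuler ^+ 8.
Proof.
rewrite x.unlock -c_sqr y.unlock c.unlock iphiN_euler {1}phi_euler {1}psi_eulerE !sub2E.
transitivity (q * V (V euler) ^+ 8 * ieuler ^+ 8
  * (V (V (V euler)) * V (V (V ieuler))) ^+ 4
  * (V (V euler) * V (V ieuler)) ^+ 2 * (V euler * V ieuler) ^+ 4); first by ring.
by rewrite !(sub2_mul_eq1, eulerV) // !expr1n !mulr1.
Qed.

(** Up to a series in q^4, which passes through both sections, the shift by q becomes multiplication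
    by [x]. *)
Lemma q_ieuler : q * ieuler ^+ 8 = x * V (V (ieuler ^+ 8)).
Proof.
rewrite x_euler !sub2E.
transitivity (q * ieuler ^+ 8 * (V (V euler) * V (V ieuler)) ^+ 8); last by ring.
by rewrite !(sub2_mul_eq1, eulerV) // expr1n mulr1.
Qed.

Lemma iphiN_v : iphiN = v * V iphiN.
Proof.
transitivity (phi * phiN * V iphiN ^+ 2 * iphiN); first by rewrite phi_phiN mul1r.
transitivity (v * V iphiN * (phiN * iphiN)); first by rewrite v.unlock; ring.
by rewrite phiNV mulr1.
Qed.

(** By [v_sqr] this is v^2 G_0. *)
Definition normalizer : fps int := phi * iphiN ^+ 8 * ieuler ^+ 8.

(** The first [U] leaves c B times known factors. Before the second, phi(-q)^-8 = v^8 phi(-q^2)^-8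
    with v^8 = 1 + 16x = 1 + 2X, so [U] acts only on B + 2 X B. The constant [k] is 1 at the first
    step and 8 afterwards. *)
Lemma sect2_sect2 k f B : lattice B -> U (x * f * v ^+ 7) = k%:R * (c * B) ->
  exists2 Q, powX Q &
    U (U (q * (ieuler ^+ 8 * iphiN ^+ 7 * f))) = k%:R * (normalizer * Q).
Proof.
move=> LB UB; exists (U (B + 2 * (X * B))).
  by apply: (proj1 (sect2_lattice _)); apply: span_add => //; apply/span_nat/span_mul.
have -> : q * (ieuler ^+ 8 * iphiN ^+ 7 * f)
    = V (V (ieuler ^+ 8) * iphiN ^+ 7) * (x * f * v ^+ 7).
  transitivity (q * ieuler ^+ 8 * iphiN ^+ 7 * f); first by ring.
  by rewrite q_ieuler {1}iphiN_v !sub2E; ring.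
rewrite sect2M UB mulrCA sect2_nat; congr (_ * _).
have -> : V (ieuler ^+ 8) * iphiN ^+ 7 * (c * B)
    = V (ieuler ^+ 8 * phi * iphiN ^+ 8) * (B + 2 * (X * B)).
  transitivity (V (ieuler ^+ 8) * V phi * iphiN ^+ 8 * B); first by rewrite c.unlock; ring.
  by rewrite {1}iphiN_v exprMn -x16E !sub2E; ring.
by rewrite sect2M /normalizer; ring.
Qed.

(** * The sections of the generating function *)

Definition diamond_sect (alpha : nat) : fps int :=
  iter alpha (fun f => U (U (q * f))) (diamond_gf 7).

(** Both sides are f_2^7 / f_1^22, as phi(-q) = f_1^2 / f_2. *)
Lemma diamond_gf7 : diamond_gf 7 = ieuler ^+ 8 * iphiN ^+ 7.
Proof.
have gf_euler : diamond_gf 7 * euler ^+ 22 = V euler ^+ 7.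
  apply: eqmod_ext => n; apply/(eqmod_le (leqnSn n)).
  have gf_prod : eqmod n.+1 (diamond_gf 7)
      (\prod_(0 <= k < n) diamond_factor 7 k.+1).
    rewrite -(big_add1 _ _ 0 n.+1 xpredT (diamond_factor 7)).
    apply: eqmod_infprod => // m m_gt0 i lt_im.
    by rewrite diamond_factor_one_mod // fcoef1.
  have := eqmodM gf_prod (eqmodX 22 (@euler_prod n)).
  move=> /eqmod_trans; apply.
  apply: eqmod_trans (eqmod_sym (eqmodX 7 (eqmodV (@euler_prod n)))).
  apply: eqmod_eq; rewrite (rmorph_prod V) -!prodrXl -big_split /=.
  apply: eq_bigr => k _; rewrite /diamond_factor divrK ?unitrX ?subXn_unit //.
  by rewrite !sub2E sub2X -exprM.
rewrite iphiN_euler; transitivity (diamond_gf 7 * euler ^+ 22 * ieuler ^+ 22).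
  by rewrite -mulrA -exprMn eulerV expr1n mulr1.
by rewrite gf_euler; ring.
Qed.

Lemma diamond_sectE alpha : exists2 Q, powX Q &
  diamond_sect alpha.+1 = (8 ^ alpha)%:R * (normalizer * Q).
Proof.
elim: alpha => [|alpha [Q powQ secQ]].
  have [B LB UB] := sect2_base.
  have [|Q powQ UQ] := @sect2_sect2 1 1 B LB; first by rewrite mulr1 mul1r.
  by exists Q; rewrite // expn0 -UQ mulr1 -diamond_gf7.
have [[B LB UB] _] := sect2_powX powQ.
have [|Q' powQ' UQ'] := @sect2_sect2 8 (v ^+ 2 * Q) B LB.
  by rewrite -UB; congr (U _); ring.
exists Q' => //; rewrite /diamond_sect iterS -/(diamond_sect alpha.+1) secQ.
have -> : q * ((8 ^ alpha)%:R * (normalizer * Q))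
    = (8 ^ alpha)%:R * (q * (ieuler ^+ 8 * iphiN ^+ 7 * (v ^+ 2 * Q))).
  by rewrite v_sqr /normalizer; ring.
by rewrite !sect2_nat UQ' expnSr natrM mulrA.
Qed.

(* The hypothesis is 3n - 1 = 4^alpha (3K - 1), without subtraction. *)
Lemma diamond_sect_coef alpha n K : (0 < K)%N ->
  (3 * n + 4 ^ alpha = 4 ^ alpha * (3 * K) + 1)%N -> (diamond_sect alpha)``_K = d 7 n.
Proof.
elim: alpha n K => [|alpha IHalpha] n K K_gt0 nK.
  by rewrite /d; congr _``__; lia.
(* The double section reads index 4K, and the factor q lowers it to 4K - 1; moreover 3(4K - 1) - 1 =
   4(3K - 1). *)
have -> : (diamond_sect alpha.+1)``_K = (diamond_sect alpha)``_((4 * K).-1).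
  rewrite /diamond_sect iterS.
  rewrite -[LHS]/((q * _)``_(K.*2.*2)) fcoefXM.
  by have -> : (K.*2.*2 = (4 * K).-1.+1)%N by lia.
by apply: IHalpha; [lia | rewrite expnS in nK; nia].
Qed.

Lemma d7_dvd alpha n K : (0 < K)%N ->
    (3 * n + 4 ^ alpha.+1 = 4 ^ alpha.+1 * (3 * K) + 1)%N ->
  ((8 ^ alpha.+1)%N%:Z %| d 7 n)%Z.
Proof.
move=> K_gt0 /(diamond_sect_coef K_gt0) <-.
have [Q /powX_dvd8[g ->] ->] := diamond_sectE alpha.
have -> : (8 ^ alpha)%:R * (normalizer * (8 * g)) = (8 ^ alpha.+1)%:R * (normalizer * g).
  by rewrite expnSr natrM; ring.
by rewrite fcoef_nat natz dvdz_mulr.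
Qed.

Lemma mod_pow4_index alpha n : (0 < n)%N -> 3 * n = 1 %[mod 4 ^ alpha.+1] ->
  exists2 K, (0 < K)%N & (3 * n + 4 ^ alpha.+1 = 4 ^ alpha.+1 * (3 * K) + 1)%N.
Proof.
move=> n_gt0 hn.
have /dvdnP[M nM] : (4 ^ alpha.+1 %| 3 * n - 1)%N.
  by rewrite -eqn_mod_dvd ?muln_gt0 //; apply/eqP.
have /dvdnP[e he] : (3 %| 4 ^ alpha.+1 - 1)%N.
  by rewrite -eqn_mod_dvd ?expn_gt0 // -modnXm exp1n.
have pow_gt0 : (0 < 4 ^ alpha.+1)%N by rewrite expn_gt0.
(* With 4^(alpha+1) = 3e + 1 and 3n - 1 = 4^(alpha+1) M, one gets 3(n - e M) = M + 1, that is M = 3K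
   - 1. *)
exists (n - e * M)%N; nia.
Qed.

End Diamonds.

Theorem theorem1p1 (n alpha : nat) (n_ge1 : (1 <= n)%N) (alpha_ge1 : (1 <= alpha)%N)
    (hn : 3 * n = 1 %[mod 4 ^ alpha]) :
  (d 7 n = 0 %[mod (8 ^ alpha)%N%:Z])%Z.
Proof.
case: alpha alpha_ge1 hn => // alpha _ /(Diamonds.mod_pow4_index n_ge1)[K K_gt0 nK].
by apply/eqP; rewrite eqz_mod_dvd GRing.subr0 (Diamonds.d7_dvd K_gt0 nK).
Qed.
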